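(* Let $\bar x\in X$. Assume that there exist $\bar y\in\mathcal S(\bar x)$, $\bar\lambda\in\Sigma(\bar x,\bar y)$ and a multiplier $\bar u$ such that $$0\in\nabla_x\mathcal L(\bar x,\bar y,\bar\lambda)+\nabla_{xy}^2\mathcal L(\bar x,\bar y,\bar\lambda)\bar u+\mathcal N_X(\bar x),$$ $$\nabla_y\mathcal L(\bar x,\bar y,\bar\lambda)=0,\qquad\nabla_{yy}^2\mathcal L(\bar x,\bar y,\bar\lambda)\bar u=0,$$ $$0\le-\nabla_yg(\bar x,\bar y)^\top\bar u-g(\bar x,\bar y)\perp\bar\lambda\ge0,\qquad0\le-g(\bar x,\bar y)\perp\bar\lambda\ge0.$$ Then $(\bar x,\bar y,\bar\lambda)$ is an S-stationary point of the mathematical program with equilibrium constraints $$(\mathrm{P_{MPEC}})\qquad\min_{x,y,\lambda} f(x,y)\quad\text{s.t. }x\in X,\ \nabla_y\mathcal L(x,y,\lambda)=0,\ 0\le-g(x,y)\perp\lambda\ge0.$$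
   Context: $f:\mathbb R^{n+m}\to\mathbb R$ and $g:\mathbb R^{n+m}\to\mathbb R^q$ are twice continuously differentiable, $-f(x,\cdot)$ and $g(x,\cdot)$ are convex for all $x\in X$, and $X=\{x\in\mathbb R^n:h(x)\le0\}$ with $h:\mathbb R^n\to\mathbb R^r$ continuously differentiable. $\mathcal F(x)=\{y\in\mathbb R^m:g(x,y)\le0\}$, $V(x)=\sup\{f(x,y):y\in\mathcal F(x)\}$, $\mathcal S(x)=\{y\in\mathcal F(x):f(x,y)=V(x)\}$. For a vector-valued map, $\nabla$ is the transposed Jacobian. $\mathcal L(x,y,\lambda)=f(x,y)-g(x,y)^\top\lambda$; $\nabla^2_{xy}\mathcal L\in\mathbb R^{n\times m}$, with $\nabla_{xy}^2\mathcal L\,u=\nabla_x(u^\top\nabla_y\mathcal L)$. $\Sigma(x,y)=\{\lambda:\nabla_y\mathcal L(x,y,\lambda)=0,\ 0\le-g(x,y)\perp\lambda\ge0\}$. $\mathcal N_X(\bar x)$ is the limiting normal cone: limits of $\xi^k\in\widehat{\mathcal N}_X(x^k)$ with $x^k\to\bar x$, $x^k\in X$, where $\widehat{\mathcal N}_X(x^* )=\{\xi:\xi^\top(x-x^* )\le o(\|x-x^*\|)\ \forall x\in X\}$. For a feasible point $(\bar x,\bar y,\bar\lambda)$ of $(\mathrm{P_{MPEC}})$ let $\mathcal I_{0+}=\{i:g_i(\bar x,\bar y)=0,\bar\lambda_i>0\}$, $\mathcal I_{+0}=\{i:-g_i(\bar x,\bar y)>0,\bar\lambda_i=0\}$, $\mathcal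 I_{00}=\{i:g_i(\bar x,\bar y)=0,\bar\lambda_i=0\}$. The point is S-stationary if there exist $(u,\alpha,\beta)\in\mathbb R^m\times\mathbb R^q\times\mathbb R^q$ such that $$0\in\nabla_xf(\bar x,\bar y)+\nabla_xg(\bar x,\bar y)\alpha+\nabla^2_{xy}\mathcal L(\bar x,\bar y,\bar\lambda)u+\mathcal N_X(\bar x),$$ $$\nabla_yf(\bar x,\bar y)+\nabla_yg(\bar x,\bar y)\alpha+\nabla^2_{yy}\mathcal L(\bar x,\bar y,\bar\lambda)u=0,\qquad-\nabla_yg(\bar x,\bar y)^\top u-\beta=0,$$ $$\nabla_y\mathcal L(\bar x,\bar y,\bar\lambda)=0,\quad0\le-g(\bar x,\bar y)\perp\bar\lambda\ge0,$$ $$\alpha_i=0\ (i\in\mathcal I_{+0}),\quad\beta_i=0\ (i\in\mathcal I_{0+}),\quad\alpha_i\ge0,\ \beta_i\ge0\ (i\in\mathcal I_{00}).$$ *)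

(* Defs.v *)
From mathcomp Require Import all_boot all_order all_algebra.
From mathcomp Require Import all_classical all_reals all_analysis.

Set Implicit Arguments.
Unset Strict Implicit.
Unset Printing Implicit Defensive.

Import Order.TTheory GRing.Theory Num.Theory.
Import numFieldNormedType.Exports.

Local Open Scope classical_set_scope.
Local Open Scope ring_scope.

(* Vectors of R^d are columns 'cV[R]_d, and maps on R^(n+m) are evaluated at
   (x, y) as F (col_mx x y). *)

Definition dot (R : realType) (d : nat) (a b : 'cV[R]_d) : R := (a^T *m b) 0 0.

(* 0 <= a _|_ b >= 0 *)
Definition complementary (R : realType) (d : nat) (a b : 'cV[R]_d) : Prop :=
  [/\ forall i, 0 <= a i 0, forall i, 0 <= b i 0 & dot a b = 0].

(* In finite dimension, continuity of z |-> 'd F z in operator norm is the same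
   as continuity of every z |-> 'D_v F z. *)
Definition C1 (R : realType) (d : nat) (W : normedModType R)
    (F : 'cV[R]_d -> W) : Prop :=
  (forall z, differentiable F z) /\ (forall v, continuous ('D_v F)).

Definition C2 (R : realType) (d : nat) (W : normedModType R)
    (F : 'cV[R]_d -> W) : Prop :=
  C1 F /\ (forall v, C1 ('D_v F)).

Definition grad (R : realType) (d : nat) (F : 'cV[R]_d -> R) (z : 'cV[R]_d) :
    'cV[R]_d :=
  \col_i 'D_(delta_mx i 0) (F : 'cV[R]_d -> R^o) z.

(* Transposed Jacobian: column j is the gradient of the j-th component. *)
Definition nabla (R : realType) (d q : nat) (F : 'cV[R]_d -> 'cV[R]_q)
    (z : 'cV[R]_d) : 'M[R]_(d, q) :=
  \matrix_(i, j) grad (fun w => F w j 0) z i 0.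

Definition frechet_normal_cone (R : realType) (n : nat) (X : set 'cV[R]_n)
    (xs : 'cV[R]_n) : set 'cV[R]_n :=
  [set xi | exists2 e : 'cV[R]_n -> R^o,
     e =o_xs (fun x => x - xs) &
     forall x, X x -> dot xi (x - xs) <= e x].

Definition limiting_normal_cone (R : realType) (n : nat) (X : set 'cV[R]_n)
    (xbar : 'cV[R]_n) : set 'cV[R]_n :=
  [set xi | exists (x_ xi_ : nat -> 'cV[R]_n),
     [/\ forall k, X (x_ k),
         forall k, frechet_normal_cone X (x_ k) (xi_ k),
         x_ @ \oo --> xbar & xi_ @ \oo --> xi]].

Definition sublevel (R : realType) (n r : nat) (h : 'cV[R]_n -> 'cV[R]_r) :
    set 'cV[R]_n :=
  [set x | forall i, h x i 0 <= 0].

Section minimax.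
Variables (R : realType) (n m q : nat).
Variables (f : 'cV[R]_(n + m) -> R) (g : 'cV[R]_(n + m) -> 'cV[R]_q).
Implicit Types (x : 'cV[R]_n) (y u : 'cV[R]_m) (lambda alpha beta : 'cV[R]_q).

Definition lower_feasible x : set 'cV[R]_m :=
  [set y | forall i, g (col_mx x y) i 0 <= 0].

Definition lower_value x : \bar R :=
  ereal_sup [set (f (col_mx x y))%:E | y in lower_feasible x].

Definition lower_solution x : set 'cV[R]_m :=
  [set y | lower_feasible x y /\ (f (col_mx x y))%:E = lower_value x].

Definition lagrangian x y lambda : R :=
  f (col_mx x y) - dot (g (col_mx x y)) lambda.

Definition grad_x (F : 'cV[R]_(n + m) -> R) x y : 'cV[R]_n :=
  grad (fun x' => F (col_mx x' y)) x.
Definition grad_y (F : 'cV[R]_(n + m) -> R) x y : 'cV[R]_m :=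
  grad (fun y' => F (col_mx x y')) y.
Definition nabla_x (F : 'cV[R]_(n + m) -> 'cV[R]_q) x y : 'M[R]_(n, q) :=
  nabla (fun x' => F (col_mx x' y)) x.
Definition nabla_y (F : 'cV[R]_(n + m) -> 'cV[R]_q) x y : 'M[R]_(m, q) :=
  nabla (fun y' => F (col_mx x y')) y.

Definition grad_xL x y lambda : 'cV[R]_n :=
  grad (fun x' => lagrangian x' y lambda) x.
Definition grad_yL x y lambda : 'cV[R]_m :=
  grad (fun y' => lagrangian x y' lambda) y.
(* hess_xyL *m u is the x-gradient of u^T grad_yL. *)
Definition hess_xyL x y lambda : 'M[R]_(n, m) :=
  nabla (fun x' => grad_yL x' y lambda) x.
Definition hess_yyL x y lambda : 'M[R]_m :=
  nabla (fun y' => grad_yL x y' lambda) y.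

Definition lower_multipliers x y : set 'cV[R]_q :=
  [set lambda | grad_yL x y lambda = 0 /\
                complementary (- g (col_mx x y)) lambda].

(* The program: min f(x, y) over the (x, y, lambda) in mpec_feasible X. *)
Definition mpec_feasible (X : set 'cV[R]_n) x y lambda : Prop :=
  [/\ X x, grad_yL x y lambda = 0 & complementary (- g (col_mx x y)) lambda].

Definition index_0p x y lambda : set 'I_q :=
  [set i | g (col_mx x y) i 0 = 0 /\ 0 < lambda i 0].
Definition index_p0 x y lambda : set 'I_q :=
  [set i | 0 < - g (col_mx x y) i 0 /\ lambda i 0 = 0].
Definition index_00 x y lambda : set 'I_q :=
  [set i | g (col_mx x y) i 0 = 0 /\ lambda i 0 = 0].

Definition mpec_S_stationary (X : set 'cV[R]_n) x y lambda : Prop :=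
  mpec_feasible X x y lambda /\
  exists u alpha beta,
    [/\ [set grad_x f x y + nabla_x g x y *m alpha
             + hess_xyL x y lambda *m u + xi
          | xi in limiting_normal_cone X x] 0,
        grad_y f x y + nabla_y g x y *m alpha + hess_yyL x y lambda *m u = 0,
        - ((nabla_y g x y)^T *m u) - beta = 0,
        grad_yL x y lambda = 0 /\ complementary (- g (col_mx x y)) lambda &
        [/\ forall i, index_p0 x y lambda i -> alpha i 0 = 0,
            forall i, index_0p x y lambda i -> beta i 0 = 0 &
            forall i, index_00 x y lambda i -> 0 <= alpha i 0 /\ 0 <= beta i 0]].

End minimax.

(* Main.v *)
Require Import Defs.
From mathcomp Require Import all_boot all_order all_algebra.
From mathcomp Require Import all_classical all_reals all_analysis.

Import Order.TTheory GRing.Theory Num.Theory.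
Import numFieldNormedType.Exports.

Local Open Scope classical_set_scope.
Local Open Scope ring_scope.

(** The conditions in the hypothesis are S-stationarity with a particular choice
    of multipliers: keep u, and set alpha := - lambda and
    beta := - (nabla_y g)^T u.  Two facts make this work.

    Since L = f - g^T lambda is affine in g with the fixed vector lambda, its
    partial gradients are grad f - (nabla g) lambda, that is,
    grad f + (nabla g) alpha ([grad_sub_dot], applied to the restrictions of f
    and g to the two blocks of variables).  This turns the first condition into
    the one for S-stationarity, and, because both grad_y L and (hess_yy L) u
    vanish, it also gives the second one.

    The sign conditions come from 0 <= beta - g _|_ lambda >= 0.  On an active
    constraint beta_i - g_i is beta_i, so beta_i >= 0, and beta_i = 0 as soon as
    lambda_i > 0 because a vanishing sum of nonnegative products has all its
    terms zero ([complementary_mul0]).  The conditions on alpha_i only concern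
    indices with lambda_i = 0, where alpha_i = 0. *)

Lemma grad_sub_dot {R : realType} {d q : nat} (F : 'cV[R]_d -> R)
    (G : 'cV[R]_d -> 'cV[R]_q) (l : 'cV[R]_q) (z : 'cV[R]_d) :
  (forall v, derivable (F : 'cV[R]_d -> R^o) z v) ->
  (forall j v, derivable (fun w => G w j 0 : R^o) z v) ->
  grad (fun w => F w - dot (G w) l) z = grad F z - nabla G z *m l.
Proof.
move=> dF dG; apply/colP => i; rewrite !mxE.
rewrite (_ : (fun w => F w - dot (G w) l) =
  (F : 'cV[R]_d -> R^o) - \sum_j (l j 0 \*: (fun w => G w j 0 : R^o))); last first.
  apply/funext => w; rewrite /dot !mxE /= [RHS]/GRing.add /=.
  congr (_ - _); rewrite fct_sumE.
  by apply: eq_bigr => j _; rewrite !mxE mulrC.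
have dlG j v : derivable (l j 0 \*: (fun w => G w j 0 : R^o)) z v.
  exact/derivableZ.
rewrite deriveB //; last exact: derivable_sum.
congr (_ - _); rewrite derive_sum //.
by apply: eq_bigr => j _; rewrite deriveZ // !mxE mulrC.
Qed.

(** The difference quotient of a slice along v is the difference quotient of F
    itself along v padded with zeros. *)
Lemma derivable_slice_x {R : realType} {n m : nat} {W : normedModType R}
    (F : 'cV[R]_(n + m) -> W) (x v : 'cV[R]_n) (y : 'cV[R]_m) :
  derivable F (col_mx x y) (col_mx v 0) ->
  derivable (fun x' => F (col_mx x' y)) x v.
Proof.
move=> dF; rewrite /derivable (_ : (fun t => _) = fun t : R =>
  t^-1 *: ((F \o shift (col_mx x y)) (t *: col_mx v 0) - F (col_mx x y))) //.
by apply/funext => t /=; rewrite scale_col_mx add_col_mx scaler0 add0r.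
Qed.

Lemma derivable_slice_y {R : realType} {n m : nat} {W : normedModType R}
    (F : 'cV[R]_(n + m) -> W) (x : 'cV[R]_n) (y v : 'cV[R]_m) :
  derivable F (col_mx x y) (col_mx 0 v) ->
  derivable (fun y' => F (col_mx x y')) y v.
Proof.
move=> dF; rewrite /derivable (_ : (fun t => _) = fun t : R =>
  t^-1 *: ((F \o shift (col_mx x y)) (t *: col_mx 0 v) - F (col_mx x y))) //.
by apply/funext => t /=; rewrite scale_col_mx add_col_mx scaler0 add0r.
Qed.

Lemma grad_xLE {R : realType} {n m q : nat} {f : 'cV[R]_(n + m) -> R}
    {g : 'cV[R]_(n + m) -> 'cV[R]_q} {x : 'cV[R]_n} {y : 'cV[R]_m}
    {l : 'cV[R]_q} :
  differentiable (f : 'cV[R]_(n + m) -> R^o) (col_mx x y) ->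
  differentiable g (col_mx x y) ->
  grad_xL f g x y l = grad_x f x y - nabla_x g x y *m l.
Proof.
move=> df dg; apply: (@grad_sub_dot _ _ _ (fun x' => f (col_mx x' y))
  (fun x' => g (col_mx x' y))) => [v|j v].
  exact/(derivable_slice_x (f : _ -> R^o))/diff_derivable.
apply: (derivable_slice_x (fun w => g w j 0 : R^o)).
have /derivable_mxP : derivable g (col_mx x y) (col_mx v 0).
  exact: diff_derivable.
exact.
Qed.

Lemma grad_yLE {R : realType} {n m q : nat} {f : 'cV[R]_(n + m) -> R}
    {g : 'cV[R]_(n + m) -> 'cV[R]_q} {x : 'cV[R]_n} {y : 'cV[R]_m}
    {l : 'cV[R]_q} :
  differentiable (f : 'cV[R]_(n + m) -> R^o) (col_mx x y) ->
  differentiable g (col_mx x y) ->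
  grad_yL f g x y l = grad_y f x y - nabla_y g x y *m l.
Proof.
move=> df dg; apply: (@grad_sub_dot _ _ _ (fun y' => f (col_mx x y'))
  (fun y' => g (col_mx x y'))) => [v|j v].
  exact/(derivable_slice_y (f : _ -> R^o))/diff_derivable.
apply: (derivable_slice_y (fun w => g w j 0 : R^o)).
have /derivable_mxP : derivable g (col_mx x y) (col_mx 0 v).
  exact: diff_derivable.
exact.
Qed.

Lemma complementary_mul0 {R : realType} {d : nat} {a b : 'cV[R]_d} :
  complementary a b -> forall i, a i 0 * b i 0 = 0.
Proof.
move=> [a0 b0 ab0] i; apply/eqP.
have: \sum_j a j 0 * b j 0 == 0.
  apply/eqP/(etrans _ ab0); rewrite /dot mxE.
  by apply: eq_bigr => j _; rewrite mxE.
rewrite psumr_eq0 => [/allP/(_ i)|j _]; last exact: mulr_ge0.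
by rewrite mem_index_enum; exact.
Qed.

Theorem theorem4p5 (R : realType) (n m q r : nat)
    (f : 'cV[R]_(n + m) -> R)
    (g : 'cV[R]_(n + m) -> 'cV[R]_q)
    (h : 'cV[R]_n -> 'cV[R]_r)
    (fC2 : C2 (f : 'cV[R]_(n + m) -> R^o))
    (gC2 : C2 g)
    (hC1 : C1 h)
    (f_concave : forall x, sublevel h x ->
       convex_function setT (fun y : 'cV[R]_m => - f (col_mx x y)))
    (g_convex : forall x, sublevel h x -> forall i : 'I_q,
       convex_function setT (fun y : 'cV[R]_m => g (col_mx x y) i 0))
    (xbar : 'cV[R]_n) (ybar : 'cV[R]_m) (lbar : 'cV[R]_q)
    (xbarX : sublevel h xbar)
    (ybarS : lower_solution f g xbar ybar)
    (lbarSigma : lower_multipliers f g xbar ybar lbar)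
    (stat : exists ubar : 'cV[R]_m,
       [/\ [set grad_xL f g xbar ybar lbar
                + hess_xyL f g xbar ybar lbar *m ubar + xi
             | xi in limiting_normal_cone (sublevel h) xbar] 0,
           grad_yL f g xbar ybar lbar = 0,
           hess_yyL f g xbar ybar lbar *m ubar = 0,
           complementary
             (- ((nabla_y g xbar ybar)^T *m ubar) - g (col_mx xbar ybar)) lbar &
           complementary (- g (col_mx xbar ybar)) lbar]) :
  mpec_S_stationary f g (sublevel h) xbar ybar lbar.
Proof.
case: stat => u [[xi Nxi statx] Ly0 Lyy0 compl_ug compl_g].
have df := fC2.1.1 (col_mx xbar ybar); have dg := gC2.1.1 (col_mx xbar ybar).
split; first by split.
(* With alpha = - lbar, grad f + (nabla g) alpha is the gradient of L. *)
exists u, (- lbar), (- ((nabla_y g xbar ybar)^T *m u)); split.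
- by exists xi => //; rewrite mulmxN -(grad_xLE df dg).
- by rewrite mulmxN -(grad_yLE df dg) Ly0 Lyy0 addr0.
- by rewrite subrr.
- by [].
- split=> i [].
  + by move=> _ li0; rewrite mxE li0 oppr0.
  + move=> gi0 li_gt0; have /eqP := complementary_mul0 compl_ug i.
    rewrite mulf_eq0 (gt_eqF li_gt0) orbF => /eqP.
    by rewrite !mxE gi0 subr0.
  + move=> gi0 li0; split; first by rewrite mxE li0 oppr0.
    by have [/(_ i) + _ _] := compl_ug; rewrite !mxE gi0 subr0.
Qed.
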